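(* If $\gamma_N\to 0$ as $N\to\infty$, then every positive rational $a/b$ with $b$ squarefree is a finite sum of distinct unit fractions each of whose denominators is a product of two distinct primes.
   Context: $p_n$ denotes the $n$-th prime and $P_N=p_1p_2\cdots p_N$. Let $D_2(N)=\{P_N/(p_ip_j):1\le i<j\le N\}$, let $L^2(N)$ be the set of all sums of subsets of $D_2(N)$ (including the empty sum $0$), and let $\sigma^2(N)=\sum_{x\in D_2(N)}x$. The gap-free floor is \[ \gamma_N=\inf\{\gamma\in\mathbb{R}:\ [\gamma P_N,\ \sigma^2(N)-\gamma P_N]\cap\mathbb{Z}\subseteq L^2(N)\}. \] *)

(* Defs.v *)
From mathcomp Require Import all_boot all_order all_algebra finmap.
From mathcomp Require Import boolp classical_sets reals topology normedtype.
Set Implicit Arguments.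
Unset Strict Implicit.
Unset Printing Implicit Defensive.
Import Order.TTheory GRing.Theory Num.Theory.
Import numFieldNormedType.Exports.

Lemma ex_prime_gt m : exists q, (m < q) && prime q.
Proof. by have [q mq pq] := prime_above m; exists q; rewrite mq. Qed.

(* Indexed from 1, i.e. p_1 = 2, p_2 = 3, ...; the value 1 at index 0 is a
   placeholder that only starts the recursion. *)
Fixpoint nth_prime (n : nat) : nat :=
  if n is k.+1 then ex_minn (ex_prime_gt (nth_prime k)) else 1.

Definition primorial (N : nat) : nat := \prod_(1 <= i < N.+1) nth_prime i.

(* iota 1 N is 1, ..., N and iota i.+1 (N - i) is i + 1, ..., N; the division
   is exact. *)
Definition D2 (N : nat) : {fset nat} :=
  [fset primorial N %/ (nth_prime i * nth_prime j)
     | i in iota 1 N, j in iota i.+1 (N - i)]%fset.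

Definition L2 (N : nat) : {fset nat} :=
  [fset (\sum_(x <- A) x)%N | A : {fset nat} in fpowerset (D2 N)]%fset.

Definition sigma2 (N : nat) : nat := \sum_(x <- D2 N) x.

(* z ranges over int, not nat, since for g < 0 the interval reaches below 0.
   The set is nonempty (the interval is empty for large g) and bounded below
   (any g <= -1 / P_N puts -1 in the interval), so inf is a true infimum. *)
Definition gap_free_floor (R : realType) (N : nat) : R :=
  inf [set g : R | forall z : int,
         (g * (primorial N)%:R <= z%:~R
            <= (sigma2 N)%:R - g * (primorial N)%:R)%R ->
         exists2 m : nat, m \in L2 N & z = Posz m].

Definition squarefree (b : nat) : Prop := forall d : nat, d ^ 2 %| b -> d = 1.

Definition product_of_two_distinct_primes (d : nat) : Prop :=
  exists p q : nat, [/\ prime p, prime q, p != q & d = p * q].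

(* Main.v *)
Require Import Defs.
From mathcomp Require Import all_boot all_order all_algebra finmap.
From mathcomp Require Import boolp classical_sets reals topology normedtype.
From mathcomp Require Import zify ring lra.
Import Order.TTheory GRing.Theory Num.Theory.
Import numFieldNormedType.Exports.

(* Since b is squarefree, b divides P_N for large N, and a/b = m/P_N with
   m = a P_N / b. Once gamma_N < a/b and sigma^2(N)/P_N >= 2a/b, the integer m
   lies in the gap-free range, and dividing its representation as a subset sum
   of D_2(N) by P_N gives the unit fractions. The second condition holds for
   large N because the terms P_N/(2 p_j) alone make sigma^2(N)/P_N at least
   half of the sum of 1/p over the odd primes p <= p_N, and the sum of prime
   reciprocals diverges: as in Erdos's proof, if its tail beyond the first k
   primes were below 1/2, more than half of the
   integers in [1, 2^e] would be products of the first k primes, but there are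
   at most (e + 1)^k of those. *)

(** * Enumeration of the primes *)

Lemma nth_primeSP k :
  [/\ nth_prime k < nth_prime k.+1, prime (nth_prime k.+1) &
      forall p, prime p -> nth_prime k < p -> nth_prime k.+1 <= p].
Proof.
rewrite /=; case: ex_minnP => q /andP[kq pq] qmin.
by split=> // p pp kp; apply: qmin; rewrite kp.
Qed.

Arguments nth_prime : simpl never.

Lemma nth_prime_prime i : 0 < i -> prime (nth_prime i).
Proof. by case: i => // i _; have [] := nth_primeSP i. Qed.

Lemma nth_prime1 : nth_prime 1 = 2.
Proof.
have [_ p1 min1] := nth_primeSP 0.
by apply/eqP; rewrite eqn_leq min1 // prime_gt1.
Qed.

Lemma nth_prime_gt0 i : 0 < nth_prime i.
Proof. by case: i => // i; apply/prime_gt0/nth_prime_prime. Qed.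

Lemma nth_prime_ltn : {homo nth_prime : i j / i < j}.
Proof.
by apply: homo_ltn => [? ? ?|i]; [exact: ltn_trans | have [] := nth_primeSP i].
Qed.

Lemma nth_prime_inj : injective nth_prime.
Proof.
by move=> i j eq_ij; case: (ltngtP i j) => // /nth_prime_ltn;
  rewrite eq_ij ltnn.
Qed.

Lemma ltn_nth_prime i : i < nth_prime i.
Proof.
elim: i => // i IHi; apply: leq_ltn_trans IHi _; exact: nth_prime_ltn.
Qed.

(** Take the least [i] with [p <= nth_prime i]: its predecessor's prime is below [p], so minimality
    of the next prime forces equality. *)
Lemma nth_prime_surj p : prime p -> exists2 i, 0 < i & nth_prime i = p.
Proof.
move=> pp; have ex_i : exists i, p <= nth_prime i.
  by exists p; apply/ltnW/ltn_nth_prime.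
case: (ex_minnP ex_i) => -[|i] le_pi min_i.
  by have := prime_gt1 pp; rewrite ltnNge le_pi.
exists i.+1 => //; apply/eqP; rewrite eqn_leq le_pi andbT.
have [_ _ -> //] := nth_primeSP i.
by rewrite ltnNge; apply/negP => /min_i; rewrite ltnn.
Qed.

(** * Divisors of the primorial *)

Lemma primorial_gt0 N : 0 < primorial N.
Proof. by apply: prodn_gt0 => i; exact: nth_prime_gt0. Qed.

Lemma nth_prime_dvd_primorial N i :
  0 < i <= N -> nth_prime i %| primorial N.
Proof.
move=> /andP[i0 iN]; rewrite /primorial (big_rem i) ?dvdn_mulr //=.
by rewrite mem_index_iota i0.
Qed.

Lemma nth_prime2_dvd_primorial N i j :
  0 < i -> i < j -> j <= N -> nth_prime i * nth_prime j %| primorial N.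
Proof.
move=> i0 ij jN; rewrite Gauss_dvd.
  by rewrite !nth_prime_dvd_primorial //; lia.
rewrite prime_coprime ?dvdn_prime2 ?nth_prime_prime //; try lia.
by apply/eqP => /nth_prime_inj; lia.
Qed.

(** Each prime factor of [b] has exponent 1 and equals some p_i with i < p_i <= b <= N, so it occurs
    in P_N. *)
Lemma squarefree_dvd_primorial b N :
  0 < b -> squarefree b -> b <= N -> b %| primorial N.
Proof.
move=> b0 sqf bN; apply/dvdn_partP => // p.
rewrite mem_primes => /and3P[pp _ pb].
rewrite p_part; have -> : logn p b = 1.
  apply/eqP; rewrite eqn_leq -(pfactor_dvdn 1) // expn1 pb andbT leqNgt.
  apply/negP; rewrite -pfactor_dvdn // => /sqf p1.
  by rewrite p1 in pp.
have [i i0 eq_ip] := nth_prime_surj _ pp.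
rewrite expn1 -eq_ip nth_prime_dvd_primorial // i0 /=.
by have := ltn_nth_prime i; have := dvdn_leq b0 pb; lia.
Qed.

(** * Divergence of the sum of prime reciprocals *)

(* Here [n] stands for the integer [n.+1]. Restricting [i] to [i < 2 ^ e] loses
   nothing, and such an integer is determined by its [k] exponents at the first
   [k] primes, each at most [e]. *)
Lemma card_smooth k e :
  #|[pred n : 'I_(2 ^ e) |
      all (fun i => ~~ (nth_prime i.+1 %| n.+1)) (index_iota k (2 ^ e))]|
    <= e.+1 ^ k.
Proof.
pose f (n : 'I_(2 ^ e)) : {ffun 'I_k -> 'I_e.+1} :=
  [ffun i : 'I_k => inord (logn (nth_prime i.+1) n.+1)].
have lognE (n : 'I_(2 ^ e)) p : prime p -> logn p n.+1 < e.+1.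
  move=> pp; rewrite ltnS -(@leq_exp2l 2) //.
  apply: (@leq_trans (p ^ logn p n.+1)).
    by case: (logn p _) => // d; rewrite leq_exp2r // prime_gt1.
  by apply: leq_trans (ltn_ord n); rewrite dvdn_leq // pfactor_dvdnn.
have -> : e.+1 ^ k = #|{ffun 'I_k -> 'I_e.+1}| by rewrite card_ffun !card_ord.
apply: (@leq_card_in _ _ f) => n m; rewrite !inE => /allP sn /allP sm eq_f.
apply/val_inj/succn_inj/eqn_from_log => // p.
case pp: (prime p); last by rewrite /logn pp.
have [[|i] // _ def_p] := nth_prime_surj _ pp; rewrite -def_p.
case: (ltnP i k) => [ik|ki].
  have /(congr1 val) := congr1 (fun g => fun_of_fin g (Ordinal ik)) eq_f.
  by rewrite !ffunE /= !inordK ?lognE ?nth_prime_prime.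
have ndvd (l : 'I_(2 ^ e)) :
    {in index_iota k (2 ^ e), forall i, ~~ (nth_prime i.+1 %| l.+1)} ->
    logn (nth_prime i.+1) l.+1 = 0.
  move=> sl; apply/eqP; rewrite eqn0Ngt -pfactor_dvdn ?nth_prime_prime // expn1.
  case: (ltnP i (2 ^ e)) => [ie|ei]; first by rewrite sl // mem_index_iota ki.
  apply/negP => /dvdn_leq; have := ltn_nth_prime i.+1; have := ltn_ord l; lia.
by rewrite !ndvd.
Qed.

(** Every integer in [1, 2^e] is either smooth or a multiple of a later prime; a union bound over
    those primes counts the multiples. *)
Lemma leq_smooth_add_sum_divn k e :
  2 ^ e <= e.+1 ^ k + \sum_(k <= i < 2 ^ e) 2 ^ e %/ nth_prime i.+1.
Proof.
pose smooth (n : 'I_(2 ^ e)) :=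
  all (fun i => ~~ (nth_prime i.+1 %| n.+1)) (index_iota k (2 ^ e)).
pose ndiv (n : 'I_(2 ^ e)) := \sum_(k <= i < 2 ^ e) (nth_prime i.+1 %| n.+1).
have smooth_or_div n : 1 <= smooth n + ndiv n.
  rewrite /smooth; have [//|/allPn[i ki /negPn dvd_i]] := boolP (all _ _).
  by rewrite /ndiv (big_rem i) //= dvd_i.
have -> : \sum_(k <= i < 2 ^ e) 2 ^ e %/ nth_prime i.+1 = \sum_n ndiv n.
  rewrite exchange_big; apply: eq_bigr => i _.
  by rewrite divn_count_dvd big_add1 big_mkord.
apply: (@leq_trans (\sum_n (smooth n + ndiv n))).
  by rewrite -[leqLHS]card_ord -sum1_card; apply: leq_sum.
rewrite big_split leq_add2r; apply: leq_trans (card_smooth k e).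
rewrite -sum1_card [leqRHS]big_mkcond; apply: leq_sum => n _.
by rewrite inE -/(smooth n); case: (smooth n).
Qed.

Lemma exists_exp_gt k : exists e, e.+1 ^ k * 2 <= 2 ^ e.
Proof.
(* With e + 1 = 2^t both sides are powers of 2, leaving t k + 1 < 2^t; here 2^t = 8 (2^k)^2 >= 8 (k
   + 1)^2. *)
pose t := k.*2 + 3; exists (2 ^ t).-1.
rewrite prednK ?expn_gt0 // -expnM -expnSr leq_exp2l //.
rewrite -ltnS prednK ?expn_gt0 //.
have k2 : k.+1 <= 2 ^ k by apply: ltn_expl.
rewrite /t -addnn !expnD; nia.
Qed.

Local Open Scope classical_set_scope.
Local Open Scope ring_scope.

Lemma sum_inv_primes_tail (F : realFieldType) k :
  exists M, 2^-1 <= \sum_(k <= i < M) ((nth_prime i.+1)%:R : F)^-1.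
Proof.
have [e le_e] := exists_exp_gt k; exists (2 ^ e)%N.
have x0 : (0 : F) < (2 ^ e)%:R by rewrite ltr0n expn_gt0.
have := leq_smooth_add_sum_divn k e.
rewrite -(ler_nat F) natrD natr_sum => le_x.
rewrite -(ler_pM2l x0) mulr_sumr.
have le_div : \sum_(k <= i < 2 ^ e) ((2 ^ e %/ nth_prime i.+1)%:R : F) <=
    \sum_(k <= i < 2 ^ e) (2 ^ e)%:R * ((nth_prime i.+1)%:R)^-1.
  apply: ler_sum => i _; rewrite ler_pdivlMr ?ltr0n ?nth_prime_gt0 //.
  by rewrite -natrM ler_nat leq_divM.
by move: le_e; rewrite -(ler_nat F) natrM; lra.
Qed.

Lemma sum_inv_primes_unbounded (F : realFieldType) C :
  exists N0, forall N, (N0 <= N)%N ->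
    C%:R <= \sum_(0 <= i < N) ((nth_prime i.+1)%:R : F)^-1.
Proof.
have term_ge0 i : 0 <= ((nth_prime i.+1)%:R : F)^-1 by rewrite invr_ge0 ler0n.
suff half D : exists N0,
    D%:R / 2 <= \sum_(0 <= i < N0) ((nth_prime i.+1)%:R : F)^-1.
  have [N0 leC] := half C.*2; exists N0 => N leN.
  rewrite (big_cat_nat _ leN) //=.
  have : 0 <= \sum_(N0 <= i < N) ((nth_prime i.+1)%:R : F)^-1.
    exact: sumr_ge0.
  by move: leC; rewrite -mul2n natrM; lra.
elim: D => [|D [N0 leD]]; first by exists 0%N; rewrite mul0r sumr_ge0.
have [M leM] := sum_inv_primes_tail F N0; exists M.
(* If [M < N0], the tail sum is empty and cannot reach 1/2. *)
have [N0M|MN0] := leqP N0 M; last first.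
  by move: leM; rewrite big_geq ?(ltnW MN0) // invr_le0 lern0.
by rewrite (big_cat_nat _ N0M) //= -natr1; lra.
Qed.

(** * The set [D2 N] and the size of its sum *)

Lemma D2P N x :
  reflect (exists i j, [/\ (0 < i)%N, (i < j)%N, (j <= N)%N &
             x = (primorial N %/ (nth_prime i * nth_prime j))%N])
          (x \in D2 N).
Proof.
apply: (iffP (imfset2P _ _ _ _ _)) => [[i + [j + ->]]|[i [j [i0 ij jN ->]]]].
  by rewrite !mem_iota => ? ?; exists i, j; split=> //; lia.
by exists i; [|exists j]; rewrite //= mem_iota; lia.
Qed.

Lemma D2_cofactor N x : x \in D2 N ->
  exists d, product_of_two_distinct_primes d /\ primorial N = (x * d)%N.
Proof.
move=> /D2P[i [j [i0 ij jN ->]]]; exists (nth_prime i * nth_prime j)%N; split.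
  exists (nth_prime i), (nth_prime j); split=> //.
  - exact: nth_prime_prime.
  - by apply: nth_prime_prime; lia.
  - by apply/eqP => /nth_prime_inj; lia.
by rewrite divnK // nth_prime2_dvd_primorial.
Qed.

Lemma sigma2_ge N :
  (\sum_(1 <= i < N) primorial N %/ (2 * nth_prime i.+1) <= sigma2 N)%N.
Proof.
pose x i := (primorial N %/ (nth_prime 1 * nth_prime i.+1))%N.
rewrite -nth_prime1 -/x -(big_map x xpredT id).
apply: (@uniq_sub_le_big _ addn leq) => //.
  by move=> u v; apply: leq_addr.
  (* [D2 N] is a set, so the chosen terms must be distinct: cancel the common value in
     [x k * (2 * nth_prime k.+1) = primorial N]. *)
  rewrite map_inj_in_uniq ?iota_uniq // => i j.
  rewrite !mem_index_iota => iN jN eq_x.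
  have dvd_x k : (0 < k < N)%N ->
      (x k * (nth_prime 1 * nth_prime k.+1) = primorial N)%N.
    by move=> ?; rewrite divnK // nth_prime2_dvd_primorial //; lia.
  have := dvd_x _ iN; rewrite -(dvd_x _ jN) eq_x => /eqP.
  have xj0 : (0 < x j)%N by have := primorial_gt0 N; rewrite -(dvd_x _ jN); lia.
  rewrite !eqn_pmul2l ?nth_prime_gt0 // => /eqP /nth_prime_inj; lia.
  exact: fset_uniq.
move=> _ /mapP[i + ->]; rewrite mem_index_iota => iN.
by apply/D2P; exists 1%N, i.+1; split=> //; lia.
Qed.

Lemma sigma2_ratio_unbounded (F : realFieldType) C :
  exists N0, forall N, (N0 <= N)%N ->
    C%:R <= (sigma2 N)%:R / (primorial N)%:R :> F.
Proof.
(* Doubling offsets the factor 1/2 from p_1 = 2; the extra 1 covers the missing term 1/p_1. *)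
have [N0 leN0] := sum_inv_primes_unbounded F C.*2.+1; exists (maxn 1 N0) => N.
rewrite geq_max => /andP[N1 /leN0].
have P0 : (0 : F) < (primorial N)%:R by rewrite ltr0n primorial_gt0.
rewrite ler_pdivlMr // => leC.
have := sigma2_ge N; rewrite -(ler_nat F); apply: le_trans.
rewrite natr_sum mulrC -ler_pdivlMl //.
have -> : (primorial N)%:R^-1 *
    \sum_(1 <= i < N) (primorial N %/ (2 * nth_prime i.+1))%:R =
    2^-1 * \sum_(1 <= i < N) ((nth_prime i.+1)%:R)^-1 :> F.
  rewrite !mulr_sumr; apply: eq_big_nat => i iN.
  have dvdP : (2 * nth_prime i.+1 %| primorial N)%N.
    by rewrite -nth_prime1 nth_prime2_dvd_primorial //; lia.
  by rewrite natf_div // natrM invfM mulKf // gt_eqF.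
move: leC; rewrite big_ltn // -mul2n -natr1 natrM.
have : ((nth_prime 1)%:R : F)^-1 <= 1.
  by rewrite invf_le1 ?ler1n ?ltr0n nth_prime_gt0.
lra.
Qed.

(** * From the gap-free floor to unit fractions *)

Lemma gap_free_floor_lt (R : realType) N (c : R) :
  gap_free_floor R N < c ->
  forall m : nat,
    c * (primorial N)%:R <= m%:R <= (sigma2 N)%:R - c * (primorial N)%:R ->
    m \in L2 N.
Proof.
have P0 : (0 : R) < (primorial N)%:R by rewrite ltr0n primorial_gt0.
have s0 : (0 : R) <= (sigma2 N)%:R by rewrite ler0n.
move=> /inf_lt[|g gap_g lt_gc m /andP[cm mc]].
  (* The infimum needs a nonempty set: this value makes the interval empty. *)
  exists ((sigma2 N)%:R / (primorial N)%:R + 1) => z.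
  rewrite mulrDl divfK ?gt_eqF // mul1r => /andP[z1 z2]; lra.
have le_gc : g * (primorial N)%:R <= c * (primorial N)%:R.
  by rewrite ler_pM2r // ltW.
have [|n nL [->] //] := gap_g m.
by rewrite (le_trans le_gc) //= (le_trans mc) // lerB.
Qed.

(** A summand x contributes x / P_N = 1 / (P_N / x), and x -> P_N / x is injective on divisors of
    P_N, so the denominators stay distinct. *)
Lemma L2_unit_fractions (F : numFieldType) N m : m \in L2 N ->
  exists S : {fset nat},
    (forall d, d \in S -> product_of_two_distinct_primes d) /\
    m%:R / (primorial N)%:R = \sum_(d <- S) (d%:R)^-1 :> F.
Proof.
move=> /imfsetP[A + ->]; rewrite /= fpowersetE => /fsubsetP AD.
have P0 := primorial_gt0 N.
have cofactor x : x \in A -> product_of_two_distinct_primes (primorial N %/ x)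
    /\ ((primorial N %/ x) * x = primorial N)%N.
  move=> /AD /D2_cofactor[d [pd eqP]].
  have x0 : (0 < x)%N by move: P0; rewrite eqP; lia.
  by rewrite eqP mulKn // mulnC.
exists [fset (primorial N %/ x)%N | x in A]%fset; split.
  by move=> _ /imfsetP[x /cofactor[px _] ->].
rewrite big_imfset /=; last first.
  move=> x y /cofactor[_ eq_x] /cofactor[_ eq_y] eq_d.
  have : (primorial N %/ x * x == primorial N %/ x * y)%N.
    by rewrite {2}eq_d eq_x eq_y.
  have d0 : (0 < primorial N %/ x)%N.
    by move: P0; rewrite -{1}eq_x muln_gt0 => /andP[].
  by rewrite eqn_pmul2l // => /eqP.
rewrite natr_sum mulr_suml; apply: eq_big_seq => x /cofactor[_ eq_x].
have x0 : (0 < x)%N by move: P0; rewrite -eq_x muln_gt0 => /andP[].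
by rewrite -[in LHS]eq_x natrM invfM mulrCA divff ?mulr1 // pnatr_eq0 -lt0n.
Qed.

Theorem proposition9p2 (R : realType)
    (gamma_to_0 : gap_free_floor R N @[N --> \oo] --> (0 : R))
    (a b : nat) (a_gt0 : (0 < a)%N) (b_gt0 : (0 < b)%N)
    (b_sqfree : squarefree b) :
  exists S : {fset nat},
    (forall d : nat, d \in S -> product_of_two_distinct_primes d) /\
    (a%:R / b%:R : rat) = \sum_(d <- S) (d%:R)^-1.
Proof.
have ab0 : 0 < a%:R / b%:R :> R by rewrite divr_gt0 ?ltr0n.
have [N0 _ leN0] := @cvgr_lt _ _ _ _ _ _ gamma_to_0 _ ab0.
(* Since [b >= 1], the integer 2a bounds 2a/b. *)
have [N1 leN1] := sigma2_ratio_unbounded R a.*2.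
pose N := maxn b (maxn N0 N1).
have bP : (b %| primorial N)%N by apply: squarefree_dvd_primorial => //; lia.
have P0 := primorial_gt0 N.
pose m := (primorial N %/ b * a)%N.
(* Stated for any field: the interval test is over [R], the conclusion over [rat]. *)
have mE (F : numFieldType) : m%:R = a%:R / b%:R * (primorial N)%:R :> F.
  by rewrite natrM natf_div //; ring.
have mL : m \in L2 N.
  have ltN : gap_free_floor R N < a%:R / b%:R by apply: leN0 => /=; lia.
  (* [m] is exactly the left endpoint for c = a/b, so only the upper bound remains. *)
  apply: (gap_free_floor_lt _ _ _ ltN); rewrite mE lexx /= lerBrDr -mulrDl.
  rewrite -ler_pdivlMr ?ltr0n //; apply: le_trans (leN1 N _); last by lia.
  rewrite -addnn natrD lerD // ler_pdivrMr ?ltr0n // ler_peMr ?ler1n //.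
have [S [S2 eqS]] := L2_unit_fractions rat _ _ mL; exists S; split=> //.
by rewrite -eqS mE mulfK // pnatr_eq0 -lt0n.
Qed.
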